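(* Let $G$ be a non-archimedean, Roelcke precompact, Polish group and let $G \curvearrowright M$ be a continuous action on a discrete, countable set. Let $\mathrm{Fin}(M)$ be the collection of finite subsets of $M$, and let $\leq$ be the quasi-order on $\mathrm{Fin}(M)$ defined by $A \leq B \iff A \subseteq \mathrm{acl}\, B$, with associated equivalence relation $\sim$ and strict relation $<$. Then the following hold: (i) The partial order $(\mathrm{Fin}(M)/{\sim}, \leq)$ is a lattice. (ii) The relation $<$ on $\mathrm{Fin}(M)$ is well-founded.
   Context: A topological group $G$ is non-archimedean if it admits a basis at $1_G$ consisting of open subgroups. It is Roelcke precompact if for every neighborhood $U$ of $1_G$ there is a finite $F \subseteq G$ with $G = UFU$. For $A \in \mathrm{Fin}(M)$, $G_A = \{g \in G : g\cdot A = A\}$ is the setwise stabilizer, and the algebraic closure is $\mathrm{acl}\,A = \{b \in M : G_A \cdot b \text{ is finite}\}$. For $A, B \in \mathrm{Fin}(M)$: $A \leq B$ iff $A \subseteq \mathrm{acl}\,B$ (equivalently $\mathrm{acl}\,A \subseteq \mathrm{acl}\,B$, equivalently the orbit $G_B\cdot A$ in $\mathrm{Fin}(M)$ is finite); $A \sim B$ iff $A \leq B$ and $B \leq A$ (equivalently $\mathrm{acl}\,A = \mathrm{acl}\,B$); $A < B$ iff $A \leq B$ and $A \not\sim B$. Well-founded means there is no infinite strictly decreasing sequence $A_0 > A_1 > \cdots$. *)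

(* Defs.v *)
From HB Require Import structures.
From mathcomp Require Import all_boot all_order all_algebra finmap.
From mathcomp Require Import generic_quotient.
From mathcomp Require Import all_classical all_reals all_analysis.

Set Implicit Arguments.
Unset Strict Implicit.
Unset Printing Implicit Defensive.

Import Order.TTheory.

Local Open Scope classical_set_scope.
Local Open Scope quotient_scope.
Local Open Scope group_scope.

HB.mixin Record isTopologicalGroup G & Topological G & Group G := {
  mulg_continuous : continuous (fun x : G * G => x.1 * x.2) ;
  invg_continuous : continuous (fun x : G => x^-1)
}.

#[short(type="topGroupType")]
HB.structure Definition TopologicalGroup :=
  {G of Topological G & Group G & isTopologicalGroup G}.

Definition separable (T : topologicalType) : Prop :=
  exists2 D : set T, countable D & dense D.

(* A compatible complete metric on T is given as a homeomorphism onto a complete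
   metric space; completeness is spelled out because the library's [completeType]
   also carries a distinguished point. *)
Definition completely_metrizable (R : realType) (T : topologicalType) : Prop :=
  exists (X : metricType R) (f : T -> X) (g : X -> T),
    [/\ cancel f g, cancel g f, continuous f, continuous g &
        forall F : set_system X, ProperFilter F -> cauchy F ->
          exists x : X, F --> x].

Definition polish (R : realType) (T : topologicalType) : Prop :=
  separable T /\ completely_metrizable R T.

Definition non_archimedean (G : topGroupType) : Prop :=
  forall U : set G, nbhs (1 : G) U ->
    exists H : set G, [/\ open H, group_closed [in H] & H `<=` U].

Definition roelcke_precompact (G : topGroupType) : Prop :=
  forall U : set G, nbhs (1 : G) U ->
    exists2 F : set G, finite_set F &
      [set: G] = [set z | exists u f v, [/\ U u, F f, U v & z = u * f * v]].

Record continuous_action (G : topGroupType) (M : discreteTopologicalType) :=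
  ContinuousAction {
    act :> G -> M -> M ;
    act1 : forall x, act 1 x = x ;
    actM : forall g h x, act (g * h) x = act g (act h x) ;
    act_continuous : continuous (fun p : G * M => act p.1 p.2)
  }.

Section AlgebraicClosure.
Context (G : topGroupType) (M : discreteTopologicalType).
Variable a : continuous_action G M.
Implicit Types (A B C : {fset M}) (b : M).

Definition setwise_stabilizer A : set G :=
  [set g | [fset a g x | x in A]%fset = A].

Definition acl A : set M :=
  [set b | finite_set [set a g b | g in setwise_stabilizer A]].

Definition acl_le A B : Prop := [set` A] `<=` acl B.

Definition acl_equiv A B : Prop := acl_le A B /\ acl_le B A.

Definition acl_lt A B : Prop := acl_le A B /\ ~ acl_equiv A B.

Lemma acl_le_refl A : acl_le A A.
Proof.
move=> b /= bA; apply: (@sub_finite_set _ _ [set` A]); last exact: finite_fset.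
by move=> _ [g /= gA <-]; rewrite -gA; apply: in_imfset.
Qed.

Lemma acl_le_trans A B C : acl_le A B -> acl_le B C -> acl_le A C.
Proof.
move=> AB BC x /AB /= fx.
pose S := \bigcup_(b in [set` B]) [set a g b | g in setwise_stabilizer C].
have fS : finite_set S by apply: bigcup_finite => // b /BC.
pose im g := [fset a g y | y in B]%fset.
pose P := [set D : {fset M} | [set` D] `<=` S].
have fP : finite_set P.
  apply: (@sub_finite_set _ _ [set` fpowerset (fset_set S)]) => [D DS|].
    by rewrite /= fpowersetE; apply/fsubsetP => y yD; rewrite in_fset_set// inE; exact: DS.
  exact: finite_fset.
pose h D := xget 1 [set g | im g = D].
pose T := \bigcup_(D in P) [set a (h D) y | y in
  [set a g x | g in setwise_stabilizer B]].
have fT : finite_set T.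
  by apply: bigcup_finite => // D _; exact: finite_image.
apply: sub_finite_set fT => _ [g gC <-].
have gP : P (im g).
  move=> y /= /imfsetP[z /= zB ->]; exists z => //.
  by exists g.
exists (im g) => //; have : im (h (im g)) = im g.
  by rewrite /h; case: xgetP => [_ _ //|/(_ g)]; case.
set k := h (im g) => kg.
exists (a (k^-1 * g) x); last by rewrite -actM mulgA mulgV mul1g.
exists (k^-1 * g) => //; apply/fsetP => y; apply/imfsetP/idP => [[z /= zB ->]|yB].
  have : a g z \in im k by rewrite kg; apply: in_imfset.
  by move=> /imfsetP[w /= wB e]; rewrite actM e -actM mulVg act1.
have : a k y \in im g by rewrite -kg; apply: in_imfset.
by move=> /imfsetP[w /= wB e]; exists w => //; rewrite actM -e -actM mulVg act1.
Qed.

Let equivb A B := `[< acl_equiv A B >].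

Let equivb_refl : reflexive equivb.
Proof. by move=> A; apply/asboolP; split; exact: acl_le_refl. Qed.

Let equivb_sym : symmetric equivb.
Proof. by move=> A B; apply/asboolP/asboolP => -[]. Qed.

Let equivb_trans : transitive equivb.
Proof.
move=> B A C /asboolP[AB BA] /asboolP[BC CB]; apply/asboolP.
by split; [exact: acl_le_trans BC|exact: acl_le_trans BA].
Qed.

Definition acl_equiv_rel : equiv_rel {fset M} :=
  EquivRel equivb equivb_refl equivb_sym equivb_trans.

Definition acl_quot := {eq_quot acl_equiv_rel}.

HB.instance Definition _ := EqQuotient.on acl_quot.
HB.instance Definition _ := Choice.on acl_quot.

Let quot_le (x y : acl_quot) : bool := `[< acl_le (repr x) (repr y) >].

Let quot_le_refl : reflexive quot_le.
Proof. by move=> x; apply/asboolP; exact: acl_le_refl. Qed.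

Let quot_le_anti : antisymmetric quot_le.
Proof.
move=> x y /andP[/asboolP xy /asboolP yx].
by rewrite -[x]reprK -[y]reprK; apply/eqP; rewrite eqmodE; apply/asboolP.
Qed.

Let quot_le_trans : transitive quot_le.
Proof.
move=> y x z /asboolP xy /asboolP yz; apply/asboolP; exact: acl_le_trans yz.
Qed.

Fact acl_display : Order.disp_t. Proof. exact: Order.Disp tt tt. Qed.

HB.instance Definition _ := Order.Le_isPOrder.Build acl_display acl_quot
  quot_le_refl quot_le_anti quot_le_trans.

(* The order on the quotient does not depend on the representatives. *)
Lemma acl_quot_leE A B :
  (\pi_(acl_quot) A <= \pi_(acl_quot) B)%O = `[< acl_le A B >].
Proof.
have repr_equiv C : acl_equiv (repr (\pi_(acl_quot) C)) C.
  apply/asboolP; change (is_true (acl_equiv_rel (repr (\pi_(acl_quot) C)) C)).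
  by rewrite -eqmodE; apply/eqP; exact: reprK.
have [A1 A2] := repr_equiv A; have [B1 B2] := repr_equiv B.
apply/asboolP/asboolP => h.
  exact: acl_le_trans (acl_le_trans A2 h) B1.
exact: acl_le_trans (acl_le_trans A1 h) B2.
Qed.

End AlgebraicClosure.

Definition is_lattice d (T : porderType d) : Prop :=
  forall x y : T,
    (exists m, infimums [set x; y] m) /\ (exists j, supremums [set x; y] j).

Definition well_founded_rel (T : Type) (lt : T -> T -> Prop) : Prop :=
  ~ exists u : nat -> T, forall n, lt (u n.+1) (u n).

(* Main.v *)
(* Joins are unions. Write [G_B] for the setwise stabilizer of [B]. The key fact
   is that if [A <= C <= B] and [G_B G_A G_B], [G_B G_C G_B] coincide, then
   [C <= A]. Indeed [G_A] is then covered by finitely many cosets of stabilizers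
   of [G_B]-translates of [C] (the orbit [G_B C] is finite), so by Neumann's
   lemma some translate satisfies [v C <= A]; hence [v C <= C], and [C <= v C]
   because the [v]-orbit of [C] is finite. By Roelcke precompactness
   [G_B G_A G_B] takes finitely many values as [A] varies. So an infinite
   descending chain would repeat a value, which is impossible; and the meet of
   two sets is obtained as a finite union of common lower bounds, one for each
   attained value. *)
Require Import Defs.
From mathcomp Require Import all_boot all_order all_algebra finmap.
From mathcomp Require Import generic_quotient.
From mathcomp Require Import all_classical all_reals all_analysis.

Local Open Scope classical_set_scope.
Local Open Scope group_scope.

Lemma finite_range_repeat (T : Type) (f : nat -> T) :
  finite_set (range f) -> exists m n, (m < n)%N /\ f m = f n.
Proof.
move=> fin; apply: contrapT => norep; apply: infinite_nat.
have -> : [set: nat] = f @^-1` range f.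
  by apply/seteqP; split=> // n _; exists n.
apply: finite_preimage fin => m n _ _ eq_f.
by case: (ltngtP m n) => // lt_mn; case: norep;
  [exists m, n|exists n, m].
Qed.

Section AclQuasiOrder.
Context {G : topGroupType} {M : discreteTopologicalType}.
Variable a : continuous_action G M.
Implicit Types (A B C D : {fset M}) (g h : G) (x y : M).

Definition act_fset g A : {fset M} := [fset a g x | x in A]%fset.

Lemma mem_act_fset g A x : x \in A -> a g x \in act_fset g A.
Proof. by move=> xA; apply: in_imfset. Qed.

Lemma act_fset1 A : act_fset 1 A = A.
Proof.
apply/fsetP => x; apply/imfsetP/idP => [[y /= yA ->]|xA]; first by rewrite act1.
by exists x; rewrite ?act1.
Qed.

Lemma act_fsetM g h A : act_fset (g * h) A = act_fset g (act_fset h A).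
Proof.
apply/fsetP => x; apply/imfsetP/imfsetP => [[y /= yA ->]|[_ /= /imfsetP[y /= yA ->] ->]].
  by exists (a h y); rewrite ?actM //; exact: mem_act_fset.
by exists y; rewrite ?actM.
Qed.

Lemma act_fsetK g A : act_fset g^-1 (act_fset g A) = A.
Proof. by rewrite -act_fsetM mulVg act_fset1. Qed.

Lemma setwise_stabilizer1 A : setwise_stabilizer a A 1.
Proof. exact: act_fset1. Qed.

Lemma setwise_stabilizerM A g h : setwise_stabilizer a A g ->
  setwise_stabilizer a A h -> setwise_stabilizer a A (g * h).
Proof.
by move=> gA hA; rewrite /setwise_stabilizer /= -/(act_fset _ _) act_fsetM
  [act_fset h A]hA.
Qed.

Lemma setwise_stabilizerV A g :
  setwise_stabilizer a A g -> setwise_stabilizer a A g^-1.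
Proof.
by move=> gA; rewrite /setwise_stabilizer /= -/(act_fset _ _) -{1}gA act_fsetK.
Qed.

Lemma setwise_stabilizerX A g n :
  setwise_stabilizer a A g -> setwise_stabilizer a A (g ^+ n).
Proof.
move=> gA; elim: n => [|n IHn]; first exact: setwise_stabilizer1.
by rewrite expgS; apply: setwise_stabilizerM.
Qed.

(** Makes Roelcke precompactness applicable: a setwise stabilizer contains the pointwise one, a
    finite intersection of neighborhoods of 1. *)
Lemma nbhs_setwise_stabilizer A : nbhs (1 : G) (setwise_stabilizer a A).
Proof.
have fix_nbhs x : nbhs (1 : G) [set g | a g x = x].
  have cont : (fun g => a g x) @ (1 : G) --> x.
    rewrite -[X in _ --> X](act1 a x).
    apply: (@cvg_comp _ _ _ (fun g => (g, x)) _ _ _ _ _ (@act_continuous _ _ a (1, x))).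
    by apply: cvg_pair => //=; exact: cvg_cst.
  exact: cont (discrete_set1 x).
have fixA : nbhs (1 : G) (\bigcap_(x in [set` A]) [set g | a g x = x]).
  by apply: filter_bigI.
apply: filterS fixA => g fix_g /=; apply/fsetP => x.
apply/imfsetP/idP => [[y /= yA ->]|xA]; first by rewrite (fix_g y).
by exists x => //; rewrite (fix_g x).
Qed.

Lemma acl_le_fsubset {A B} : (A `<=` B)%fset -> acl_le a A B.
Proof. by move=> /fsubsetP AB x /AB; exact: acl_le_refl. Qed.

Lemma acl_leU A B C : acl_le a A C -> acl_le a B C -> acl_le a (A `|` B)%fset C.
Proof. by move=> leAC leBC x /=; rewrite in_fsetU => /orP[/leAC|/leBC]. Qed.

Lemma acl_le_act g A B :
  acl_le a A B -> acl_le a (act_fset g A) (act_fset g B).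
Proof.
move=> AB _ /imfsetP[x /= /AB finx ->].
apply: sub_finite_set (finite_image (a g) finx) => _ [h hgB <-].
exists (a (g^-1 * h * g) x); last by rewrite -!actM !mulgA mulgV mul1g.
exists (g^-1 * h * g) => //; rewrite /setwise_stabilizer /= -/(act_fset _ _).
by rewrite !act_fsetM [act_fset h _]hgB act_fsetK.
Qed.

(* An action-theoretic form of B. H. Neumann's covering lemma: if finitely many
   cosets [{h in H : h x = y}] with [x] in [s] and [y] in [Y] cover [H], then
   one of the stabilizers of the points of [s] has finite index. If [x0] is the
   head of [s] and [g0 x0] lies outside [Y], the coset [{h : h x0 = g0 x0}] is
   covered by those attached to the tail, and hence so are its translates
   [{h : h x0 = y}]; this removes [x0] at the cost of enlarging [Y]. *)
Lemma neumann_covering (A : {fset M}) (s : seq M) (Y : set M) :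
  finite_set Y ->
  (forall h, setwise_stabilizer a A h -> exists2 x, x \in s & Y (a h x)) ->
  exists2 x, x \in s & acl a A x.
Proof.
elim: s Y => [|x0 s IHs] Y finY cover.
  by have [] := cover 1 (setwise_stabilizer1 A).
have [subY|] := pselect ([set a g x0 | g in setwise_stabilizer a A] `<=` Y).
  exists x0; first exact: mem_head.
  exact: sub_finite_set subY finY.
move=> /existsNP[_ /not_implyP[[g0 g0A <-] g0Y]].
pose k y := xget 1 [set g | setwise_stabilizer a A g /\ a g (a g0 x0) = y].
pose Y' := Y `|` \bigcup_(y in Y) (a (k y) @` Y).
have [||x xs clx] := IHs Y'.
- rewrite finite_setU; split=> //; apply: bigcup_finite => // y _.
  exact: finite_image.
- move=> h hA; have [x] := cover h hA; rewrite inE => /orP[/eqP-> Yh|xs Yh]; last first.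
    by exists x => //; left.
  have [kA ka] : setwise_stabilizer a A (k (a h x0)) /\
      a (k (a h x0)) (a g0 x0) = a h x0.
    rewrite /k; case: xgetP => [g _ //|/(_ (h * g0^-1))]; case; split.
      by apply: setwise_stabilizerM => //; exact: setwise_stabilizerV.
    by rewrite -actM mulgVK.
  set g1 := k _ in kA ka.
  (* [g1^-1 * h] sends [x0] to [a g0 x0], outside [Y], so its covering point lies in the tail
     [s]. *)
  have [|z zs Yz] := cover (g1^-1 * h).
    by apply: setwise_stabilizerM => //; exact: setwise_stabilizerV.
  move: zs; rewrite inE => /orP[/eqP ez|zs].
    by case: g0Y; move: Yz; rewrite ez actM -ka -actM mulVg act1.
  exists z => //; right; exists (a h x0) => //; exists (a (g1^-1 * h) z) => //.
  by rewrite -/g1 -actM mulgA mulgV mul1g.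
by exists x => //; rewrite inE xs orbT.
Qed.

Definition double_coset B A : set G :=
  [set z | exists u h v, [/\ setwise_stabilizer a B u,
    setwise_stabilizer a A h, setwise_stabilizer a B v & z = u * h * v]].

Lemma finite_orbit_fset A B : acl_le a A B ->
  finite_set (\bigcup_(x in [set` A]) [set a g x | g in setwise_stabilizer a B]).
Proof. by move=> AB; apply: bigcup_finite => // x /AB. Qed.

(** Otherwise each translate of [C] by the stabilizer of [B] has a point outside [acl A]. An element
    [u * h * v] of the stabilizer of [A] sends such a point of [v^-1 C] into [u C], hence into the
    finite set [Y], and Neumann's covering puts one of these points in [acl A]. *)
Lemma double_coset_sub_act_le {A B C} : acl_le a C B ->
  double_coset B A `<=` double_coset B C ->
  exists2 v, setwise_stabilizer a B v & acl_le a (act_fset v C) A.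
Proof.
move=> leCB sub; set Y := \bigcup_(x in [set` C]) [set a g x | g in setwise_stabilizer a B].
have finY : finite_set Y by exact: finite_orbit_fset.
apply: contrapT => noV.
pose s := [seq x <- fset_set Y | ~~ `[< acl a A x >]].
have [|x] := @neumann_covering A s Y finY; last first.
- by rewrite mem_filter => /andP[/asboolP].
- move=> g gA; have [|u [h [v [uB hC vB def_g]]]] := sub g.
    exists 1, g, 1; split=> //; try exact: setwise_stabilizer1.
    by rewrite mul1g mulg1.
  have vVB := setwise_stabilizerV _ _ vB.
  have [x xvC nclx] : exists2 x, x \in act_fset v^-1 C & ~ acl a A x.
    apply: contrapT => all_cl; case: noV; exists v^-1 => // x xvC.
    by apply: contrapT => nclx; case: all_cl; exists x.
  move/imfsetP: xvC => [y /= yC def_x]; exists x.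
    rewrite mem_filter; apply/andP; split; first exact/asboolP.
    by rewrite in_fset_set // inE; exists y => //; exists v^-1.
  exists (a h y); first by rewrite /= -[C]hC; exact: mem_act_fset.
  by exists u; rewrite // def_x def_g -!actM mulgK.
Qed.

(* If [v] is in the stabilizer of [B], the sets [v^n C] range over a finite set,
   so the descending sequence [C >= v C >= v^2 C >= ...] is constant up to
   interalgebraicity. *)
Lemma acl_le_act_stable {B C v} : acl_le a C B -> setwise_stabilizer a B v ->
  acl_le a (act_fset v C) C -> acl_le a C (act_fset v C).
Proof.
move=> leCB vB vC.
have [|m [n [lt_mn eq_mn]]] := @finite_range_repeat _ (fun n => act_fset (v ^+ n) C).
  set Y := \bigcup_(x in [set` C]) [set a g x | g in setwise_stabilizer a B].
  apply: (@sub_finite_set _ _ [set` fpowerset (fset_set Y)]); last exact: finite_fset.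
  move=> _ [n _ <-]; rewrite /= fpowersetE; apply/fsubsetP => _ /imfsetP[x /= xC ->].
  rewrite in_fset_set ?inE; last exact: finite_orbit_fset.
  by exists x => //; exists (v ^+ n) => //; exact: setwise_stabilizerX.
have le_iter k : acl_le a (act_fset (v ^+ k.+1) C) (act_fset v C).
  elim: k => [|k IHk]; first by rewrite expg1; exact: acl_le_refl.
  rewrite expgS act_fsetM; apply: acl_le_act.
  exact: acl_le_trans IHk vC.
(* Cancelling [v ^+ m] in the repetition shows that [v ^+ (n - m)] fixes [C]. *)
have := le_iter (n - m).-1; rewrite prednK ?subn_gt0 //.
have -> // : act_fset (v ^+ (n - m)) C = C.
have := congr1 (act_fset (v ^+ m)^-1) eq_mn.
by rewrite act_fsetK -(subnKC (ltnW lt_mn)) expgnDr act_fsetM act_fsetK subnKC // ltnW.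
Qed.

Lemma acl_le_of_double_coset {A B C} : acl_le a A C -> acl_le a C B ->
  double_coset B A `<=` double_coset B C -> acl_le a C A.
Proof.
move=> leAC leCB sub; have [v vB vCA] := double_coset_sub_act_le leCB sub.
exact: acl_le_trans (acl_le_act_stable leCB vB (acl_le_trans vCA leAC)) vCA.
Qed.

(* By Roelcke precompactness, there are only finitely many double cosets of
   the stabilizer of [B]; the invariant records those contained in
   [double_coset B A]. *)
Lemma finite_acl_invariant B : roelcke_precompact G ->
  exists (S : {fset {fset G}}) (inv : {fset M} -> {fset G}),
    (forall A, inv A \in S) /\
    forall A C, acl_le a A C -> acl_le a C B -> inv A = inv C -> acl_le a C A.
Proof.
move=> /(_ _ (nbhs_setwise_stabilizer B))[F finF coverF].
pose inv A := [fset g in fset_set F | `[< double_coset B A g >]]%fset.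
exists (fpowerset (fset_set F)), inv; split.
  by move=> A; rewrite fpowersetE; apply/fsubsetP => g; rewrite !inE => /andP[].
move=> A C leAC leCB eq_inv; apply: (acl_le_of_double_coset leAC leCB) => g.
have [u [f [v [uB Ff vB def_g]]]] : [set z | exists u f v,
    [/\ setwise_stabilizer a B u, F f, setwise_stabilizer a B v & z = u * f * v]] g.
  by rewrite -coverF.
move=> [u' [h [v' [u'B hA v'B def_g']]]].
(* [double_coset B A] is a union of double cosets of the stabilizer of [B], so it contains [f]
   because it contains [g]. *)
have : f \in inv C.
  rewrite -eq_inv !inE in_fset_set //; apply/andP; split; first by rewrite inE.
  apply/asboolP.
  exists (u^-1 * u'), h, (v' * v^-1); split.
  - by apply: setwise_stabilizerM => //; exact: setwise_stabilizerV.
  - by [].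
  - by apply: setwise_stabilizerM => //; exact: setwise_stabilizerV.
  by rewrite !mulgA -(mulgA u^-1) -(mulgA u^-1) -def_g' def_g !mulgA mulVg mul1g mulgK.
rewrite !inE => /andP[_ /asboolP[p [k [q [pB kC qB def_f]]]]].
exists (u * p), k, (q * v); split.
- exact: setwise_stabilizerM.
- by [].
- exact: setwise_stabilizerM.
by rewrite def_g def_f !mulgA.
Qed.

Lemma acl_meet A B : roelcke_precompact G ->
  exists C, [/\ acl_le a C A, acl_le a C B &
    forall D, acl_le a D A -> acl_le a D B -> acl_le a D C].
Proof.
move=> G_rp; have [S [inv [invS invP]]] := finite_acl_invariant A G_rp.
pose lower s D := [/\ acl_le a D A, acl_le a D B & inv D = s].
(* An unattained value gets [fset0], trivially a lower bound. *)
pose rep s := xget fset0 (lower s).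
have repP s : acl_le a (rep s) A /\ acl_le a (rep s) B.
  by rewrite /rep; case: xgetP => [D _ [] //|_]; split; apply: acl_le_fsubset; rewrite fsub0set.
pose C := (\bigcup_(s <- S) rep s)%fset.
have leCA : acl_le a C A by move=> x /bigfcupP[s _ /(proj1 (repP s))].
have leCB : acl_le a C B by move=> x /bigfcupP[s _ /(proj2 (repP s))].
exists C; split=> // D DA DB.
(* [rep (inv E)] lies below [C], hence below [E], and has the same invariant; so [E] lies below it,
   and [D] below [C]. *)
pose E := (D `|` C)%fset.
have EA : acl_le a E A by exact: acl_leU.
have EB : acl_le a E B by exact: acl_leU.
have repC : acl_le a (rep (inv E)) C.
  by apply/acl_le_fsubset/fsubsetP => x xr; apply/bigfcupP; exists (inv E); rewrite ?invS.
have inv_rep : inv (rep (inv E)) = inv E.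
  by rewrite /rep; case: xgetP => [D' _ [] //|/(_ E)]; case.
apply: acl_le_trans (acl_le_fsubset (fsubsetUl D C)) _.
apply: (acl_le_trans _ repC); apply: invP EA inv_rep.
exact: acl_le_trans repC (acl_le_fsubset (fsubsetUr D C)).
Qed.

Lemma acl_lt_well_founded : roelcke_precompact G -> well_founded_rel (acl_lt a).
Proof.
move=> G_rp [u u_lt]; have [S [inv [invS invP]]] := finite_acl_invariant (u 0%N) G_rp.
have u_le m n : (m <= n)%N -> acl_le a (u n) (u m).
  move=> /subnK <-; elim: (n - m)%N => [|k IHk]; first exact: acl_le_refl.
  exact: acl_le_trans (proj1 (u_lt _)) IHk.
(* A repeated invariant at [m < n] gives [u m <= u n <= u m.+1], against strict descent. *)
have [|m [n [lt_mn eq_inv]]] := @finite_range_repeat _ (inv \o u).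
  by apply: sub_finite_set (finite_fset S) => _ [n _ <-]; exact: invS.
have [le_m nequiv] := u_lt m; apply: nequiv; split=> //.
apply: acl_le_trans (u_le _ _ lt_mn).
exact: invP (u_le _ _ (ltnW lt_mn)) (u_le _ _ (leq0n m)) (esym eq_inv).
Qed.

Lemma acl_quot_lattice : roelcke_precompact G -> is_lattice (acl_quot a).
Proof.
move=> G_rp x y; rewrite -[x]reprK -[y]reprK.
set A := repr x; set B := repr y; split.
  have [C [leCA leCB Cmax]] := acl_meet A B G_rp.
  exists (\pi_(acl_quot a)%qT C); split.
    by move=> _ [->|->]; rewrite acl_quot_leE; exact/asboolP.
  move=> z lb_z; rewrite -[z]reprK acl_quot_leE; apply/asboolP.
  by apply: Cmax; apply/asboolP; rewrite -acl_quot_leE (reprK z); apply: lb_z; [left|right].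
exists (\pi_(acl_quot a)%qT (A `|` B)%fset); split.
  by move=> _ [->|->]; rewrite acl_quot_leE; apply/asboolP/acl_le_fsubset;
    [exact: fsubsetUl|exact: fsubsetUr].
move=> z ub_z; rewrite -[z]reprK acl_quot_leE; apply/asboolP.
by apply: acl_leU; apply/asboolP; rewrite -acl_quot_leE (reprK z); apply: ub_z; [left|right].
Qed.

End AclQuasiOrder.

Theorem theorem2p4 (R : realType) (G : topGroupType)
    (M : discreteTopologicalType) (a : continuous_action G M)
    (G_na : non_archimedean G) (G_rp : roelcke_precompact G)
    (G_polish : polish R G) (M_countable : countable [set: M]) :
  is_lattice (acl_quot a) /\ well_founded_rel (acl_lt a).
Proof.
by split; [exact: acl_quot_lattice|exact: acl_lt_well_founded].
Qed.
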